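(* Let $\mathcal{F}\times\Theta$ be a class of pairs $(f^*,\boldsymbol{\theta})$ indexing distributions $\mathbf{P}_{(f^*,\boldsymbol{\theta})}$ as described in the context, and assume that for every $(f^*,\boldsymbol{\theta})\in\mathcal{F}\times\Theta$ the measures $\nu^*_s=\mathrm{Law}(f^*(\boldsymbol{X},S)\mid S=s)$, $s\in[K]$, are non-atomic with finite second moments. Fix $t\in(0,1)$ and let $\delta_n=\delta_n(\mathcal{F},\Theta,t)>0$ satisfy $$\inf_{\hat f}\sup_{(f^*,\boldsymbol{\theta})\in\mathcal{F}\times\Theta}\mathbf{P}_{(f^*,\boldsymbol{\theta})}\big(\mathcal{R}(\hat f)\ge\delta_n\big)\ge t,$$ where the infimum is over all estimators. Then for every $\alpha\in[0,1]$ and $t'\in(0,1)$, $$\inf_{\hat f\in\widehat{\mathcal{F}}_{(\alpha,t')}}\sup_{(f^*,\boldsymbol{\theta})\in\mathcal{F}\times\Theta}\mathbf{P}_{(f^*,\boldsymbol{\theta})}\Big(\mathcal{R}^{1/2}(\hat f)\ge\delta_n^{1/2}\vee(1-\sqrt{\alpha})\,\mathcal{U}^{1/2}(f^* )\Big)\ge t\wedge(1-t').$$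
   Context: Setting: for each $(f^*,\boldsymbol{\theta})\in\mathcal{F}\times\Theta$, $f^*:\mathbb{R}^p\times[K]\to\mathbb{R}$ is a regression function and $\boldsymbol{\theta}$ a nuisance parameter; together they determine the joint distribution of a random triple $(\boldsymbol{X},S,Y)\in\mathbb{R}^p\times[K]\times\mathbb{R}$ with $Y=f^*(\boldsymbol{X},S)+\xi$, $\mathbb{E}[\xi\mid\boldsymbol{X}]=0$, and $\mathbf{P}_{(f^*,\boldsymbol{\theta})}$ is the joint law of an i.i.d. sample of size $n$ from it. An estimator $\hat f$ is a measurable map from the sample to measurable functions $\mathbb{R}^p\times[K]\to\mathbb{R}$. Fix $\boldsymbol{w}\in\Delta^{K-1}$. For a prediction $f$ (evaluated with the sample fixed), with respect to the distribution indexed by $(f^*,\boldsymbol\theta)$: $\mathcal{R}(f)=\sum_{s}w_s\mathbb{E}[(f(\boldsymbol{X},S)-f^*(\boldsymbol{X},S))^2\mid S=s]$ and $\mathcal{U}(f)=\min_{\nu\in\mathcal{P}_2(\mathbb{R})}\sum_s w_s\mathsf{W}_2^2(\mathrm{Law}(f(\boldsymbol{X},S)\mid S=s),\nu)$ ($\mathsf{W}_2$ the Wasserstein-2 distance, $\mathcal{P}_2(\mathbb{R})$ probability measures with finite second moment). An estimator $\hat f$ is $(\alpha,t')$-valid if $\inf_{(f^*,\boldsymbol{\theta})\in\mathcal{F}\times\Theta}\mathbf{P}_{(f^*,\boldsymbol{\theta})}(\mathcal{U}(\hat f)\le\alpha\,\mathcal{U}(f^* ))\ge1-t'$; $\widehat{\mathcal{F}}_{(\alpha,t')}$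 is the set of all such estimators. $a\vee b=\max$, $a\wedge b=\min$. *)

(* Defs.v *)
From HB Require Import structures.
From mathcomp Require Import all_boot all_order all_algebra.
From mathcomp Require Import all_classical all_reals all_analysis.

Set Implicit Arguments.
Unset Strict Implicit.
Unset Printing Implicit Defensive.

Import Order.TTheory GRing.Theory Num.Theory.
Local Open Scope classical_set_scope.
Local Open Scope ring_scope.

(* The group index set [K] = {1,...,K}, for K >= 1.  We use the type   *)
(* 'I_(K.-1.+1), which is 'I_K whenever 0 < K (assumed in the theorem).*)
Definition grp (K : nat) : Type := 'I_K.-1.+1.
HB.instance Definition _ K := Finite.on (grp K).
HB.instance Definition _ K := isPointed.Build (grp K) ord0.
HB.instance Definition _ K := @isMeasurable.Build default_measure_display
  (grp K) discrete_measurable discrete_measurable0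
  discrete_measurableC discrete_measurableU.

Section Model.
Variables (R : realType) (p K n : nat).

Definition feat : Type := p.-tuple R.
Definition obs : Type := (feat * grp K * R)%type.
Definition sample : Type := n.-tuple obs.
Definition regfun : Type := feat -> grp K -> R.

Definition obsX (o : obs) : feat := o.1.1.
Definition obsS (o : obs) : grp K := o.1.2.
Definition obsY (o : obs) : R := o.2.

Definition measurable_regfun (f : regfun) : Prop :=
  measurable_fun [set: (feat * grp K)%type] (fun z => f z.1 z.2).

(* Outer probability (used so that P(E) makes sense for every event E,
   measurable or not; it coincides with P on measurable events). *)
Definition outerP {d} {T : measurableType d} (P : probability T R)
  (A : set T) : \bar R :=
  ereal_inf [set P B | B in [set B | measurable B /\ A `<=` B]].

(* mu is the law of (X,S,Y) with Y = f(X,S) + xi, E[xi | X] = 0: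
   f measurable, xi integrable, and E[xi 1_{X in A}] = 0 for all
   measurable A in R^p. *)
Definition regression_model (mu : probability obs R) (f : regfun) : Prop :=
  measurable_regfun f /\
  mu.-integrable [set: obs] (fun o => (obsY o - f (obsX o) (obsS o))%:E) /\
  forall A : set feat, measurable A ->
    (\int[mu]_(o in [set o | A (obsX o)]) (obsY o - f (obsX o) (obsS o))%:E
      = 0)%E.

(* Pn is the joint law of an i.i.d. sample of size n from mu
   (product rule on all measurable rectangles, which characterizes the
   product measure). *)
Definition iid_sample_law (Pn : probability sample R) (mu : probability obs R)
  : Prop :=
  forall A : 'I_n -> set obs, (forall i, measurable (A i)) ->
    Pn [set D : sample | forall i, A i (tnth D i)] = (\prod_(i < n) mu (A i))%E.

Definition grpset (s : grp K) : set obs := [set o | obsS o = s].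

Definition condlaw (mu : probability obs R) (f : regfun) (s : grp K)
  (B : set R) : \bar R :=
  (mu (grpset s `&` [set o | B (f (obsX o) (obsS o))])
     * ((fine (mu (grpset s)))^-1)%:E)%E.

Definition condE2 (mu : probability obs R) (h : regfun) (s : grp K) : \bar R :=
  ((\int[mu]_(o in grpset s) ((h (obsX o) (obsS o)) ^+ 2)%:E)
     * ((fine (mu (grpset s)))^-1)%:E)%E.

Definition risk (w : grp K -> R) (mu : probability obs R) (fstar f : regfun)
  : \bar R :=
  (\sum_(s : grp K) (w s)%:E * condE2 mu (fun x s' => (f x s' - fstar x s')%R) s)%E.

Definition coupling (m : set R -> \bar R) (nu : probability R R)
  (pi : probability (R * R)%type R) : Prop :=
  (forall A : set R, measurable A -> pi (A `*` [set: R]) = m A) /\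
  (forall B : set R, measurable B -> pi ([set: R] `*` B) = nu B).

Definition W2sq (m : set R -> \bar R) (nu : probability R R) : \bar R :=
  ereal_inf [set (\int[pi]_z ((z.1 - z.2) ^+ 2)%:E)%E
            | pi in [set pi | coupling m nu pi]].

Definition P2 (nu : probability R R) : Prop :=
  (\int[nu]_x (x ^+ 2)%:E < +oo)%E.

Definition unfairness (w : grp K -> R) (mu : probability obs R) (f : regfun)
  : \bar R :=
  ereal_inf [set (\sum_(s : grp K) (w s)%:E * W2sq (condlaw mu f s) nu)%E
            | nu in P2].

Definition estimator (fhat : sample -> regfun) : Prop :=
  measurable_fun [set: (sample * (feat * grp K))%type]
    (fun z => fhat z.1 z.2.1 z.2.2).

Definition valid {Theta : Type} (w : grp K -> R)
  (F : set regfun) (Th : set Theta)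
  (mu : regfun -> Theta -> probability obs R)
  (Pn : regfun -> Theta -> probability sample R)
  (alpha t' : R) (fhat : sample -> regfun) : Prop :=
  (ereal_inf [set outerP (Pn ft.1 ft.2)
       [set D | (unfairness w (mu ft.1 ft.2) (fhat D)
                   <= alpha%:E * unfairness w (mu ft.1 ft.2) ft.1)%E]
     | ft in [set ft : regfun * Theta | F ft.1 /\ Th ft.2]]
   >= (1 - t')%:E)%E.

End Model.

(* Main.v *)
(* If every instance satisfies (1 - sqrt alpha) U(f^star)^(1/2) <= delta^(1/2),
   the claim is the minimax hypothesis.  Otherwise fix an instance violating
   this: on the event U(fhat) <= alpha U(f^star), of probability at least
   1 - t', the triangle inequality
     U(f^star)^(1/2) <= U(fhat)^(1/2) + R(fhat)^(1/2)
   yields R(fhat)^(1/2) >= (1 - sqrt alpha) U(f^star)^(1/2).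
   The triangle inequality is used in the squared form
     U(f^star) <= U(fhat) / a + R(fhat) / b   for a, b > 0, a + b < 1,
   in which it is linear and so passes through the integrals, the sum over
   groups and the infima.  Couplings are glued without disintegration, by
   discretizing the common marginal to a grid of arbitrarily small mesh; the
   error is absorbed by the slack 1 - a - b. *)
Require Import Defs.
From HB Require Import structures.
From mathcomp Require Import all_boot all_order all_algebra.
From mathcomp Require Import all_classical all_reals all_analysis.
From mathcomp Require Import measurable_realfun ring lra.

Import Order.TTheory GRing.Theory Num.Theory.
Local Open Scope classical_set_scope.
Local Open Scope ring_scope.

(** * Laws, restricted measures and gluing along partitions *)

Lemma pushforward_probability {d1 d2} {T : measurableType d1}
    {U : measurableType d2} {R : realType} (P : probability T R) (f : T -> U) :
  measurable_fun [set: T] f ->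
  exists Q : probability U R, forall A, Q A = P (f @^-1` A).
Proof.
move=> mf.
pose X : {mfun T >-> U} := HB.pack f (isMeasurableFun.Build _ _ _ _ f mf).
by exists (distribution P X).
Qed.

(** Change of variables for a law known on measurable sets only, which is all that the marginals of
    a coupling provide. *)
Lemma ge0_integral_law {d1 d2} {T : measurableType d1} {U : measurableType d2}
    {R : realType} (P : probability T R) (Q : probability U R) (f : T -> U)
    (h : U -> \bar R) :
  measurable_fun [set: T] f ->
  (forall A, measurable A -> Q A = P (f @^-1` A)) ->
  measurable_fun [set: U] h -> (forall x, 0 <= h x)%E ->
  (\int[Q]_x h x = \int[P]_x h (f x))%E.
Proof.
move=> mf QP mh h0.
have := ge0_integral_pushforward mf P measurableT mh (fun x _ => h0 x).
rewrite preimage_setT => <-.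
by apply: eq_measure_integral => A mA _; exact: QP.
Qed.

Lemma ge0_integral_mrestr {d} {T : measurableType d} {R : realType}
    (mu : {measure set T -> \bar R}) (D : set T) (mD : measurable D)
    (h : T -> \bar R) :
  measurable_fun [set: T] h -> (forall x, 0 <= h x)%E ->
  (\int[mrestr mu mD]_x h x = \int[mu]_(x in D) h x)%E.
Proof.
move=> mh h0.
rewrite (@ge0_negligible_integral _ _ _ _ setT (~` D))//; last 2 first.
- exact: measurableC.
- by rewrite /= /mrestr setICl measure0.
rewrite setTD setCK; apply: eq_measure_integral => A mA AD.
by rewrite /= /mrestr setIidl.
Qed.

(* [G] makes the two points conditionally independent given the index of the
   cell they share:
   [G = \sum_k (P1 (D1 k))^-1 * P1(. `&` D1 k) \x P2(. `&` D2 k)]. *)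
Lemma glue_partitions {d1 d2} {T1 : measurableType d1} {T2 : measurableType d2}
    {R : realType} (P1 : probability T1 R) (P2 : probability T2 R)
    (D1 : nat -> set T1) (D2 : nat -> set T2) :
  (forall k, measurable (D1 k)) -> (forall k, measurable (D2 k)) ->
  trivIset [set: nat] D1 -> trivIset [set: nat] D2 ->
  \bigcup_k D1 k = [set: T1] -> \bigcup_k D2 k = [set: T2] ->
  (forall k, P1 (D1 k) = P2 (D2 k)) ->
  exists G : probability (T1 * T2)%type R,
    [/\ forall A, measurable A -> G (A `*` [set: T2]) = P1 A,
        forall B, measurable B -> G ([set: T1] `*` B) = P2 B &
        G (~` \bigcup_k (D1 k `*` D2 k)) = 0%E].
Proof.
move=> mD1 mD2 tD1 tD2 UD1 UD2 P12.
have mD k : measurable (D1 k `*` D2 k) by exact: measurableX.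
have c0 k : 0 <= (fine (P1 (D1 k)))^-1 by rewrite invr_ge0 fine_ge0.
pose m k : {measure set (T1 * T2) -> \bar R} :=
  mscale (NngNum (c0 k)) (mrestr (P1 \x P2)%E (mD k)).
pose G0 : {measure set (T1 * T2) -> \bar R} := mseries m 0.
(* On a null cell the inverse is 0 by convention, and the right side vanishes by monotonicity. *)
have PE k A : measurable A ->
    (((fine (P1 (D1 k)))^-1)%:E * (P1 (A `&` D1 k) * P2 (D2 k))
     = P1 (A `&` D1 k))%E.
  move=> mA; have [P0|P0] := eqVneq (P1 (D1 k)) 0%E.
    rewrite -P12 P0 mule0 mule0; apply/esym/eqP; rewrite eq_le measure_ge0 andbT.
    by rewrite -P0 le_measure ?inE//; exact: measurableI.
  rewrite -P12 muleCA -{2}(@fineK _ (P1 (D1 k))) ?fin_num_measure//.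
  by rewrite -EFinM mulVf ?mule1// fine_eq0// fin_num_measure.
have PE' k B : measurable B ->
    (((fine (P1 (D1 k)))^-1)%:E * (P1 (D1 k) * P2 (B `&` D2 k))
     = P2 (B `&` D2 k))%E.
  move=> mB; have [P0|P0] := eqVneq (P1 (D1 k)) 0%E.
    rewrite P0 mul0e mule0; apply/esym/eqP; rewrite eq_le measure_ge0 andbT.
    by rewrite -P0 P12 le_measure ?inE//; exact: measurableI.
  rewrite muleA -{2}(@fineK _ (P1 (D1 k))) ?fin_num_measure//.
  by rewrite -EFinM mulVf ?mul1e// fine_eq0// fin_num_measure.
have G1 A : measurable A -> G0 (A `*` [set: T2]) = P1 A.
  move=> mA; rewrite /G0 /= /mseries.
  transitivity (\sum_(0 <= k <oo) P1 (A `&` D1 k))%E.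
    apply: eq_eseriesr => k _; rewrite /m /= /mscale /= /mrestr.
    rewrite -setXI setTI product_measure1E ?PE//; exact: measurableI.
  rewrite -measure_semi_bigcup.
  - by rewrite -setI_bigcupr UD1 setIT.
  - by move=> k; exact: measurableI.
  - exact: trivIset_setIl.
  - by rewrite -setI_bigcupr UD1 setIT.
have G2 B : measurable B -> G0 ([set: T1] `*` B) = P2 B.
  move=> mB; rewrite /G0 /= /mseries.
  transitivity (\sum_(0 <= k <oo) P2 (B `&` D2 k))%E.
    apply: eq_eseriesr => k _; rewrite /m /= /mscale /= /mrestr.
    rewrite -setXI setTI product_measure1E ?PE'//; exact: measurableI.
  rewrite -measure_semi_bigcup.
  - by rewrite -setI_bigcupr UD2 setIT.
  - by move=> k; exact: measurableI.
  - exact: trivIset_setIl.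
  - by rewrite -setI_bigcupr UD2 setIT.
(* [G0] has total mass 1, so normalizing leaves it unchanged and only supplies the probability
   structure. *)
have GE A : mnormalize G0 (P1 \x P2)%E A = G0 A.
  rewrite /mnormalize -setXTT G1// probability_setT.
  by rewrite onee_eq0/= invr1 mule1.
exists (mnormalize G0 (P1 \x P2)%E).
split => [A mA|B mB|]; rewrite [LHS]GE ?G1 ?G2//.
rewrite /G0 /= /mseries eseries0// => k _ _; rewrite /m /= /mscale /= /mrestr.
rewrite (_ : _ `&` _ = set0) ?measure0 ?mule0//.
by apply/seteqP; split => // z [/= zD Dz]; apply: zD; exists k.
Qed.

(** * Grid cells and the effect on transport cost of changing one marginal *)

(** Weighted Cauchy-Schwarz: as [p + q + r = 1], the gap is the sum of squares in Lagrange's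
    identity. *)
Lemma sqr_sum3_le {R : realFieldType} (p q r u v x : R) :
  0 < p -> 0 < q -> 0 < r -> p + q + r = 1 ->
  (u + v + x) ^+ 2 <= p^-1 * u ^+ 2 + q^-1 * v ^+ 2 + r^-1 * x ^+ 2.
Proof.
move=> p0 q0 r0 pqr.
have E : p^-1 * u ^+ 2 + q^-1 * v ^+ 2 + r^-1 * x ^+ 2 - (u + v + x) ^+ 2 =
   (u * q - v * p) ^+ 2 / (p * q) + (u * r - x * p) ^+ 2 / (p * r)
   + (v * r - x * q) ^+ 2 / (q * r).
  have -> : r = 1 - p - q by rewrite -pqr; ring.
  have r0' : 1 - p - q != 0 by apply: lt0r_neq0; lra.
  by field; rewrite r0' !lt0r_neq0.
rewrite -subr_ge0 E !addr_ge0// divr_ge0 ?sqr_ge0// mulr_ge0 ?ltW//.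
Qed.

(** [pickle] turns the integer index of a half-open cell into a natural number, as [glue_partitions]
    requires; a number that codes no cell gives the empty set. *)
Lemma measurable_grid_cell {R : realType} (e : R) (k : nat) :
  measurable [set x : R | pickle (Num.floor (x / e)) = k].
Proof.
have [[x0 /= x0k]|nex] :=
    pselect (exists x : R, pickle (Num.floor (x / e)) = k); last first.
  rewrite [X in measurable X](_ : _ = set0)//.
  by apply/seteqP; split => // x xk; apply: nex; exists x.
set i := Num.floor (x0 / e).
rewrite [X in measurable X](_ : _ =
    (fun x => x / e) @^-1` `[i%:~R, (i + 1)%:~R[%classic); last first.
  apply/seteqP; split => x /=; rewrite in_itv/= -floor_eq.
  - by rewrite -x0k => /(pcan_inj pickleK)/eqP.
  - by move=> /eqP ->.
rewrite -[X in measurable X]setTI.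
by apply: measurable_funM => //; exact: measurable_itv.
Qed.

Lemma grid_cell_dist {R : realType} (e x y : R) : 0 < e ->
  pickle (Num.floor (x / e)) = pickle (Num.floor (y / e)) ->
  (x - y) ^+ 2 <= e ^+ 2.
Proof.
move=> e0 /(pcan_inj pickleK) xy.
have /andP[] := floor_itv (x / e); have /andP[] := floor_itv (y / e).
rewrite -xy; move: (Num.floor _) => i; rewrite intrD.
rewrite ler_pdivlMr// ltr_pdivrMr// ler_pdivlMr// ltr_pdivrMr//.
move=> y1 y2 x1 x2; rewrite -ler_sqrt ?sqr_ge0// !sqrtr_sqr (gtr0_norm e0).
by rewrite ler_norml; apply/andP; split; lra.
Qed.

(** Draw [x] from [P] and [(y, z)] from [pi] so that [f x] and [y] share a grid cell; then
    [(g x, z)] couples [m] with [nu], and [g x - z] splits into [y - z], [g x - f x] and the small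
    [f x - y]. *)
Lemma W2sq_le_transport {d} {T : measurableType d} {R : realType}
    (P : probability T R) (f g : T -> R) (m : set R -> \bar R)
    (nu : probability R R) (pi : probability (R * R)%type R) (p q : R) :
  measurable_fun [set: T] f -> measurable_fun [set: T] g ->
  (forall A, measurable A -> m A = P (g @^-1` A)) ->
  coupling (fun A => P (f @^-1` A)) nu pi ->
  0 < p -> 0 < q -> p + q < 1 ->
  (W2sq m nu <= p^-1%:E * \int[pi]_z ((z.1 - z.2) ^+ 2)%:E
              + q^-1%:E * \int[P]_x ((f x - g x) ^+ 2)%:E)%E.
Proof.
move=> mf mg mP [pi1 pi2] p0 q0 pq1.
apply/lee_addgt0Pr => eta eta0.
pose r := 1 - p - q.
have r0 : 0 < r by rewrite /r; lra.
(* The mesh is chosen so that [r^-1 * e ^+ 2 = eta]. *)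
pose e := Num.sqrt (r * eta).
have e0 : 0 < e by rewrite sqrtr_gt0 mulr_gt0.
pose C k := [set x : R | pickle (Num.floor (x / e)) = k].
have mC k : measurable (C k) by exact: measurable_grid_cell.
have tC U (h : U -> R) : trivIset setT (fun k => h @^-1` C k).
  apply/trivIsetP => i j _ _ /eqP ij; apply/seteqP; split => // x [/= xi xj].
  by apply: ij; rewrite -xi -xj.
(* Corresponding cells have equal mass because the first marginal of [pi] is the law of [f]. *)
have [|||||||G [G1 G2 G3]] := @glue_partitions _ _ _ _ _ P pi
    (fun k => f @^-1` C k) (fun k => fst @^-1` C k).
- by move=> k; rewrite -[X in measurable X]setTI; exact: mf.
- by move=> k; rewrite -[X in measurable X]setTI; exact: measurable_fst.
- exact: tC.
- exact: tC.
- by apply/seteqP; split => // x _; exists (pickle (Num.floor (f x / e))).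
- by apply/seteqP; split => // x _; exists (pickle (Num.floor (x.1 / e))).
- move=> k; rewrite -pi1//; congr (pi _).
  by apply/seteqP; split => [[x y] []|[x y]].
have mh : measurable_fun [set: T * (R * R)] (fun z => (g z.1, z.2.2)).
  apply: measurable_fun_pair.
    exact: measurableT_comp mg measurable_fst.
  exact: measurableT_comp measurable_snd measurable_snd.
have [Q QE] := pushforward_probability G _ mh.
have cQ : coupling m nu Q.
  split => [A mA|B mB]; rewrite QE.
    rewrite mP// -G1; last by rewrite -[X in measurable X]setTI; exact: mg.
    by congr (G _); apply/seteqP; split => [[x y] []|[x y] []].
  rewrite -pi2// -G2; last exact: measurableX.
  by congr (G _); apply/seteqP; split => [[x [y z]] []|[x [y z]] [_ []]].
have mdist : measurable_fun [set: R * R] (fun z => ((z.1 - z.2) ^+ 2)%:E).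
  apply/measurable_EFinP; apply: measurable_funX.
  by apply: measurable_funB; [exact: measurable_fst|exact: measurable_snd].
have mfg : measurable_fun [set: T] (fun x => ((f x - g x) ^+ 2)%:E).
  by apply/measurable_EFinP; apply: measurable_funX; exact: measurable_funB.
(* All integrals, the constant [eta] included, are moved to [G], which reduces the claim to an
   inequality of integrands. *)
have -> : (\int[pi]_z ((z.1 - z.2) ^+ 2)%:E
    = \int[G]_z ((z.2.1 - z.2.2) ^+ 2)%:E)%E.
  apply: (ge0_integral_law _ _ _ _ measurable_snd _ mdist) => [A mA|z].
    by rewrite -G2// setTX.
  by rewrite lee_fin sqr_ge0.
have -> : (\int[P]_x ((f x - g x) ^+ 2)%:E
    = \int[G]_z ((f z.1 - g z.1) ^+ 2)%:E)%E.
  apply: (ge0_integral_law _ _ _ _ measurable_fst _ mfg) => [A mA|z].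
    by rewrite -G1// setXT.
  by rewrite lee_fin sqr_ge0.
apply: ge_ereal_inf; eexists; first by exists Q; first exact: cQ.
rewrite (ge0_integral_law _ _ _ _ mh (fun A _ => QE A) mdist); last first.
  by move=> z; rewrite lee_fin sqr_ge0.
have mdist2 := measurableT_comp mdist (@measurable_snd _ _ T (R * R)%type).
have mfg1 := measurableT_comp mfg (@measurable_fst _ _ T (R * R)%type).
rewrite -ge0_integralZl//; last 2 first.
- by move=> z _; rewrite lee_fin sqr_ge0.
- by rewrite lee_fin invr_ge0 ltW.
rewrite -ge0_integralZl//; last 2 first.
- by move=> z _; rewrite lee_fin sqr_ge0.
- by rewrite lee_fin invr_ge0 ltW.
have -> : (eta%:E = \int[G]_z (eta%:E))%E.
  by rewrite integral_cst// [X in (_ * X)%E](@probability_setT _ _ _ G) mule1.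
have sq0 (c x : R) : 0 < c -> (0 <= c^-1%:E * (x ^+ 2)%:E)%E.
  by move=> c0; rewrite -EFinM lee_fin mulr_ge0 ?sqr_ge0// invr_ge0 ltW.
have mdist3 := measurable_funeM p^-1%:E mdist2.
have mfg2 := measurable_funeM q^-1%:E mfg1.
rewrite -ge0_integralD//; last 2 first.
- by move=> z _; exact: sq0.
- by move=> z _; exact: sq0.
rewrite -ge0_integralD//; last 3 first.
- by move=> z _; rewrite adde_ge0// sq0.
- exact: emeasurable_funD.
- by move=> z _; rewrite lee_fin ltW.
apply: ae_ge0_le_integral => //.
- by move=> z _; rewrite lee_fin sqr_ge0.
- exact: measurableT_comp mdist mh.
- by move=> z _; rewrite !adde_ge0 ?sq0// lee_fin ltW.
- by apply: emeasurable_funD => //; exact: emeasurable_funD.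
(* The integrands compare wherever the two points share a cell, hence off a [G]-null set. *)
exists (~` \bigcup_k ((f @^-1` C k) `*` ((@fst R R) @^-1` C k))).
split => //.
- apply: measurableC; apply: bigcupT_measurable => k; apply: measurableX.
    by rewrite -[X in measurable X]setTI; exact: mf.
  by rewrite -[X in measurable X]setTI; exact: measurable_fst.
- apply: subsetC => z [k _ [/= zk1 zk2]] _.
  have xe := grid_cell_dist e (f z.1) z.2.1 e0 (etrans zk1 (esym zk2)).
  rewrite -!EFinM -!EFinD lee_fin.
  have -> : g z.1 - z.2.2 = (z.2.1 - z.2.2) + (g z.1 - f z.1)
    + (f z.1 - z.2.1) by ring.
  have := sqr_sum3_le p q r (z.2.1 - z.2.2) (g z.1 - f z.1)
    (f z.1 - z.2.1) p0 q0 r0.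
  have -> : p + q + r = 1 by rewrite /r; ring.
  move=> /(_ erefl) /le_trans; apply.
  rewrite -(sqrrN (g _ - _)) opprB lerD2l mulrC ler_pdivrMr// mulrC.
  by rewrite (le_trans xe)// sqr_sqrtr// mulr_ge0// ltW.
Qed.

(** * Conditioning on an event, and affine bounds on infima *)

(** Presents [condlaw] and [condE2] as a law and an expectation under one genuine probability, to
    which the transport bound applies. *)
Lemma conditional_probability {d} {T : measurableType d} {R : realType}
    (mu : probability T R) (D : set T) : measurable D -> mu D != 0%E ->
  exists P : probability T R,
    (forall A, P A = mu (D `&` A) * ((fine (mu D))^-1)%:E)%E /\
    (forall h : T -> \bar R,
       measurable_fun [set: T] h -> (forall x, 0 <= h x)%E ->
       \int[P]_x h x = (\int[mu]_(x in D) h x) * ((fine (mu D))^-1)%:E)%E.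
Proof.
move=> mD D0; pose m : {measure set T -> \bar R} := mrestr mu mD.
have PE A : mnormalize m mu A = (mu (D `&` A) * ((fine (mu D))^-1)%:E)%E.
  rewrite /mnormalize /m /= /mrestr setTI (negbTE D0)/=.
  by rewrite lt_eqF 1?setIC// ltey_eq fin_num_measure.
exists (mnormalize m mu); split => [A|h mh h0]; first exact: PE.
have c0 : 0 <= (fine (mu D))^-1 by rewrite invr_ge0 fine_ge0.
rewrite (eq_measure_integral (mscale (NngNum c0) m)) => [|A mA _]; last first.
  by rewrite /= [LHS]PE /mscale /= /mrestr setIC muleC.
by rewrite ge0_integral_mscale// ge0_integral_mrestr// muleC.
Qed.

Lemma le_mule_ereal_infD {R : realType} (S : set (\bar R)) (a : R)
    (W b : \bar R) :
  0 < a -> (0 <= b)%E -> (forall x, S x -> 0 <= x)%E ->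
  (forall x, S x -> W <= a%:E * x + b)%E -> (W <= a%:E * ereal_inf S + b)%E.
Proof.
move=> a0 b0 S0 WS; case: b b0 WS => [b| |//] b0 WS.
  rewrite -leeBlDr// -ereal_inf_pZl//; apply: le_ereal_inf_tmp => _ [x Sx <-].
  by rewrite leeBlDr//; exact: WS.
(* Here [b] is [+oo]; the product is not [-oo], so the right side is [+oo]. *)
have aS0 : (0 <= a%:E * ereal_inf S)%E.
  by apply: mule_ge0; [rewrite lee_fin ltW|exact: le_ereal_inf_tmp].
by rewrite addey ?leey//; apply: contraTneq aS0 => ->.
Qed.

Lemma W2sq_ge0 {R : realType} (m : set R -> \bar R) (nu : probability R R) :
  (0 <= W2sq m nu)%E.
Proof.
apply: le_ereal_inf_tmp => _ [pi _ <-].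
by apply: integral_ge0 => z _; rewrite lee_fin sqr_ge0.
Qed.

(** * Comparison of risk and unfairness *)

Section Regression.
Context {R : realType} {p K : nat}.
Implicit Types (mu : probability (obs R p K) R) (f g h : regfun R p K).

Let ev f (o : obs R p K) : R := f (obsX o) (obsS o).

Let measurable_ev f : measurable_regfun f ->
  measurable_fun [set: obs R p K] (ev f).
Proof. by move=> mf; exact: measurableT_comp mf measurable_fst. Qed.

Lemma measurable_grpset s : measurable (@grpset R p K s).
Proof.
have mS : measurable_fun [set: obs R p K] (@obsS R p K).
  exact: measurableT_comp measurable_snd measurable_fst.
by rewrite -[X in measurable X]setTI; exact: (mS _ [set s]).
Qed.

Lemma condE2_ge0 mu h s : (0 <= condE2 mu h s)%E.
Proof.
rewrite mule_ge0 ?lee_fin ?invr_ge0 ?fine_ge0//.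
by apply: integral_ge0 => z _; rewrite lee_fin sqr_ge0.
Qed.

Lemma W2sq_condlaw_le mu f g s (nu : probability R R) (a b : R) :
  measurable_regfun f -> measurable_regfun g -> mu (grpset s) != 0%E ->
  0 < a -> 0 < b -> a + b < 1 ->
  (W2sq (condlaw mu g s) nu <= a^-1%:E * W2sq (condlaw mu f s) nu
    + b^-1%:E * condE2 mu (fun x s' => (f x s' - g x s')%R) s)%E.
Proof.
move=> /measurable_ev mf /measurable_ev mg mus a0 b0 ab.
have [P [PA PI]] := conditional_probability mu _ (measurable_grpset s) mus.
apply: le_mule_ereal_infD.
- by rewrite invr_gt0.
- by rewrite mule_ge0 ?condE2_ge0// lee_fin invr_ge0 ltW.
- move=> _ [pi _ <-]; apply: integral_ge0 => z _.
  by rewrite lee_fin sqr_ge0.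
move=> _ [pi [pi1 pi2] <-]; rewrite /condE2 -PI.
- apply: (W2sq_le_transport P (ev f) (ev g)) => //.
  by split => // A mA; rewrite pi1// PA.
- by apply/measurable_EFinP; apply: measurable_funX; exact: measurable_funB.
- by move=> x; rewrite lee_fin sqr_ge0.
Qed.

(** The coupling is the conditional law of [(g, 0)], whose cost is the second moment of [g]. *)
Lemma W2sq_condlaw_dirac0 mu g s :
  measurable_regfun g -> mu (grpset s) != 0%E ->
  (W2sq (condlaw mu g s) (@dirac _ R 0%R R) <= condE2 mu g s)%E.
Proof.
move=> /measurable_ev mg mus.
have [P [PA PI]] := conditional_probability mu _ (measurable_grpset s) mus.
have mh : measurable_fun [set: obs R p K] (fun o => (ev g o, 0 : R)).
  exact: measurable_fun_pair.
have [Q QE] := pushforward_probability P _ mh.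
apply: ge_ereal_inf; exists (\int[Q]_z ((z.1 - z.2) ^+ 2)%:E)%E.
  exists Q => //; split => [A mA|B mB]; rewrite QE.
    by rewrite PA; congr (mu (_ `&` _) * _)%E; apply/seteqP; split => [x []|].
  rewrite [RHS]diracE; have [B0|B0] := boolP (0 \in B).
    rewrite (_ : _ @^-1` _ = setT) ?probability_setT//.
    by apply/seteqP; split => // x _; split => //=; rewrite -in_setE.
  rewrite (_ : _ @^-1` _ = set0) ?measure0//.
  by apply/seteqP; split => // x [_ /=] /mem_set; rewrite (negbTE B0).
rewrite (ge0_integral_law _ _ _ _ mh (fun A _ => QE A)); last 2 first.
- apply/measurable_EFinP; apply: measurable_funX.
  by apply: measurable_funB; [exact: measurable_fst|exact: measurable_snd].
- by move=> z; rewrite lee_fin sqr_ge0.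
rewrite PI.
- by under eq_integral do rewrite /= subr0.
- by apply/measurable_EFinP; apply: measurable_funX; exact: measurable_funB.
- by move=> x; rewrite lee_fin sqr_ge0.
Qed.

Section Weights.
Variables (w : grp K -> R).
Hypothesis w0 : forall s, 0 <= w s.

Let sum_ge0 (x : grp K -> \bar R) :
  (forall s, 0 <= x s)%E -> (0 <= \sum_s (w s)%:E * x s)%E.
Proof. by move=> x0; apply: sume_ge0 => s _; rewrite mule_ge0// lee_fin. Qed.

Lemma risk_ge0 mu g f : (0 <= risk w mu g f)%E.
Proof. by apply: sum_ge0 => s; exact: condE2_ge0. Qed.

Lemma unfairness_ge0 mu f : (0 <= unfairness w mu f)%E.
Proof.
apply: le_ereal_inf_tmp => _ [nu _ <-].
by apply: sum_ge0 => s; exact: W2sq_ge0.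
Qed.

(** Any [nu] competing for [f] also competes for [g], so the groupwise bounds are summed with
    weights [w s] at fixed [nu] before the infimum is taken. *)
Lemma unfairness_le_risk mu f g (a b : R) :
  measurable_regfun f -> measurable_regfun g ->
  (forall s, mu (grpset s) != 0%E) -> 0 < a -> 0 < b -> a + b < 1 ->
  (unfairness w mu g <= a^-1%:E * unfairness w mu f
                        + b^-1%:E * risk w mu g f)%E.
Proof.
move=> mf mg mus a0 b0 ab; apply: le_mule_ereal_infD.
- by rewrite invr_gt0.
- by rewrite mule_ge0 ?risk_ge0// lee_fin invr_ge0 ltW.
- by move=> _ [nu _ <-]; apply: sum_ge0 => s; exact: W2sq_ge0.
move=> _ [nu nu2 <-]; apply: ge_ereal_inf.
exists (\sum_s (w s)%:E * W2sq (condlaw mu g s) nu)%E; first by exists nu.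
rewrite /risk !ge0_sume_distrr; last 2 first.
- by move=> s _; rewrite mule_ge0 ?condE2_ge0// lee_fin.
- by move=> s _; rewrite mule_ge0 ?W2sq_ge0// lee_fin.
rewrite -big_split/=; apply: lee_sum => s _.
rewrite !(muleCA _ (w s)%:E) -ge0_muleDr; last 2 first.
- by rewrite mule_ge0 ?W2sq_ge0// lee_fin invr_ge0 ltW.
- by rewrite mule_ge0 ?condE2_ge0// lee_fin invr_ge0 ltW.
by rewrite lee_wpmul2l ?lee_fin//; exact: W2sq_condlaw_le.
Qed.

(** The Dirac mass at 0 is a competitor of finite cost; finiteness lets [risk_ge] compute with real
    numbers. *)
Lemma unfairness_lty mu g : measurable_regfun g ->
  (forall s, mu (grpset s) != 0%E) -> (forall s, condE2 mu g s < +oo)%E ->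
  (unfairness w mu g < +oo)%E.
Proof.
move=> mg mus g2.
apply: (@le_lt_trans _ _ (\sum_s (w s)%:E * condE2 mu g s)%E).
  apply: ge_ereal_inf.
  exists (\sum_s (w s)%:E * W2sq (condlaw mu g s) (@dirac _ R 0%R R))%E.
    exists (@dirac _ R 0%R R) => //; rewrite /P2 integral_dirac//.
      by rewrite diracT mul1e ltry.
    by apply/measurable_EFinP; exact: measurable_funX.
  apply: lee_sum => s _; rewrite lee_wpmul2l ?lee_fin//.
  exact: W2sq_condlaw_dirac0.
by apply: lte_sum_pinfty => s _; rewrite lte_mul_pinfty// lee_fin.
Qed.

(* If the risk were smaller, [x := sqrt (risk / unfairness)] would satisfy
   [sqrt alpha + x < 1]; the weights [sqrt alpha + k] and [x + k] then
   contradict [unfairness_le_risk]. *)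
Lemma risk_ge mu f g (alpha : R) :
  measurable_regfun f -> measurable_regfun g ->
  (forall s, mu (grpset s) != 0%E) -> (forall s, condE2 mu g s < +oo)%E ->
  0 <= alpha <= 1 ->
  (unfairness w mu f <= alpha%:E * unfairness w mu g)%E ->
  (((1 - Num.sqrt alpha) ^+ 2)%:E * unfairness w mu g <= risk w mu g f)%E.
Proof.
move=> mf mg mus g2 /andP[al0 al1] fg.
have key a b a0 b0 ab := unfairness_le_risk mu f g a b mf mg mus a0 b0 ab.
have := unfairness_lty mu g mg mus g2.
have := unfairness_ge0 mu g; have := unfairness_ge0 mu f; have := risk_ge0 mu g f.
move: key fg; move: (unfairness w mu g) (unfairness w mu f) (risk w mu g f).
(* Infinite risk makes the claim trivial; from here on [U] and [r] are real. *)
move=> [U| |]// V [r| |]// key VU; rewrite ?leey// => r0 V0 U0 _.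
move: r0 U0; rewrite -EFinM !lee_fin => r0 U0; rewrite leNgt; apply/negP.
move=> rU.
set s := Num.sqrt alpha in rU.
have s0 : 0 <= s by exact: sqrtr_ge0.
have s2 : s ^+ 2 = alpha by rewrite sqr_sqrtr.
have s1 : s <= 1 by rewrite -(sqrtr1 R) ler_sqrt.
have U1 : 0 < U.
  rewrite lt0r U0 andbT; apply: contraTneq rU => ->.
  by rewrite mulr0 -leNgt.
set x := Num.sqrt (r / U).
have x0 : 0 <= x by exact: sqrtr_ge0.
have x2 : r = x ^+ 2 * U by rewrite sqr_sqrtr ?divr_ge0// mulfVK// gt_eqF.
have xs : s + x < 1.
  rewrite addrC -ltrBrDr -(@ltr_pXn2r _ 2)// ?nnegrE ?subr_ge0//.
  by rewrite -(ltr_pM2r U1) -x2.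
(* A third of the gap: the weights [s + k] and [x + k] are positive even if [s] or [x] is 0, and sum
   to [1 - k]. *)
pose k := (1 - s - x) / 3.
have k0 : 0 < k by rewrite divr_gt0//; lra.
have div_le (y : R) : 0 <= y -> (y + k)^-1 * y ^+ 2 <= y.
  by move=> y0; rewrite ler_pdivrMl ?ltr_wpDl// expr2 mulrDl lerDl mulr_ge0// ltW.
have ab1 : (s + k) + (x + k) < 1 by rewrite /k; lra.
have sk0 : 0 < s + k by rewrite ltr_wpDl.
have xk0 : 0 < x + k by rewrite ltr_wpDl.
have := key _ _ sk0 xk0 ab1; apply/negP; rewrite -ltNge.
(* By [div_le] the two terms are at most [s * U] and [x * U], and [s + x < 1]. *)
apply: (@le_lt_trans _ _ (((s + x) * U)%:E)); last first.
  by rewrite lte_fin gtr_pMl.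
rewrite mulrDl EFinD; apply: leeD; last first.
  by rewrite -EFinM lee_fin x2 mulrA ler_wpM2r// div_le.
apply: (@le_trans _ _ ((s + k)^-1%:E * (s ^+ 2 * U)%:E)%E).
  by apply: lee_wpmul2l; rewrite ?lee_fin ?invr_ge0 ?(ltW sk0)// s2 EFinM.
by rewrite -EFinM lee_fin mulrA ler_wpM2r// div_le.
Qed.

End Weights.
End Regression.

(** * Outer probability and the minimax bound *)

Lemma le_outerP {d} {T : measurableType d} {R : realType} (P : probability T R)
    (A B : set T) : A `<=` B -> (outerP P A <= outerP P B)%E.
Proof.
move=> AB; apply: ereal_inf_le_tmp => _ [C [mC BC] <-].
by exists C => //; split => //; exact: subset_trans BC.
Qed.

Theorem theorem2 (R : realType) (p K n : nat) (hK : (0 < K)%N)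
  (w : grp K -> R) (hw0 : forall s, 0 <= w s) (hw1 : \sum_(s : grp K) w s = 1)
  (Theta : Type) (F : set (regfun R p K)) (Th : set Theta)
  (mu : regfun R p K -> Theta -> probability (obs R p K) R)
  (Pn : regfun R p K -> Theta -> probability (sample R p K n) R)
  (hmodel : forall f th, F f -> Th th -> regression_model (mu f th) f)
  (hiid : forall f th, F f -> Th th -> iid_sample_law (Pn f th) (mu f th))
  (hnu : forall f th, F f -> Th th -> forall s : grp K,
     [/\ condlaw (mu f th) f s [set: R] = 1%E,
         (forall x : R, condlaw (mu f th) f s [set x] = 0%E) &
         (condE2 (mu f th) f s < +oo)%E])
  (t : R) (ht : 0 < t < 1) (delta : R) (hdelta : 0 < delta)
  (hminimax : forall fhat : sample R p K n -> regfun R p K,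
     estimator fhat ->
     (ereal_sup [set outerP (Pn ft.1 ft.2)
                   [set D | (delta%:E <= risk w (mu ft.1 ft.2) ft.1 (fhat D))%E]
                | ft in [set ft : regfun R p K * Theta | F ft.1 /\ Th ft.2]]
      >= t%:E)%E)
  (alpha t' : R) (halpha : 0 <= alpha <= 1) (ht' : 0 < t' < 1) :
  forall fhat : sample R p K n -> regfun R p K,
    estimator fhat -> valid w F Th mu Pn alpha t' fhat ->
    (ereal_sup [set outerP (Pn ft.1 ft.2)
        [set D | (maxe (delta%:E `^ 2^-1)
                       ((1 - Num.sqrt alpha)%:E
                          * unfairness w (mu ft.1 ft.2) ft.1 `^ 2^-1)
                  <= risk w (mu ft.1 ft.2) ft.1 (fhat D) `^ 2^-1)%E]
      | ft in [set ft : regfun R p K * Theta | F ft.1 /\ Th ft.2]]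
     >= (Num.min t (1 - t'))%:E)%E.
Proof.
move=> fhat hfhat hvalid.
have [/andP[al0 al1] /andP[t'0 t'1]] := (halpha, ht').
have al0' : 0 <= 1 - Num.sqrt alpha by rewrite subr_ge0 -(sqrtr1 R) ler_sqrt.
have [[[f th] [[/= Ff Thth] large]]|small] := pselect (exists ft,
    (F ft.1 /\ Th ft.2) /\ (delta%:E `^ 2^-1 <
      (1 - Num.sqrt alpha)%:E * unfairness w (mu ft.1 ft.2) ft.1 `^ 2^-1)%E).
- have [mf _] := hmodel f th Ff Thth.
  have mus s : mu f th (grpset s) != 0%E.
    (* For a null group the convention [0^-1 = 0] would make [condlaw] vanish on the whole line,
       against its total mass 1. *)
    have [+ _ _] := hnu f th Ff Thth s; apply: contra_eq_neq => mu0.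
    by rewrite /condlaw mu0 /= invr0 mule0 eq_sym onee_eq0.
  have f2 s : (condE2 (mu f th) f s < +oo)%E by have [] := hnu f th Ff Thth s.
  have mfhat D : measurable_regfun (fhat D).
    exact: measurableT_comp hfhat (pair1_measurable D).
  apply: le_ereal_sup_tmp; eexists; first by exists (f, th).
  apply: (@le_trans _ _ (1 - t')%:E).
    by rewrite lee_fin ge_min lexx orbT.
  (* Validity at this instance reduces the claim to an inclusion of events. *)
  apply: (le_trans hvalid); apply: ge_ereal_inf.
  eexists; first by exists (f, th).
  apply: le_outerP => D /= fair; rewrite ge_max.
  have R0 := risk_ge0 w hw0 (mu f th) f (fhat D).
  have U0 := unfairness_ge0 w hw0 (mu f th) f.
  (* By [large] the second term of the maximum dominates. *)
  suff H : ((1 - Num.sqrt alpha)%:E * unfairness w (mu f th) f `^ 2^-1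
            <= risk w (mu f th) f (fhat D) `^ 2^-1)%E.
    by rewrite H (le_trans (ltW large)).
  have := risk_ge w hw0 (mu f th) (fhat D) f alpha (mfhat D) mf mus f2
    halpha fair.
  rewrite !poweR12_sqrt// -lee_sqrt// sqrteM ?lee_fin ?sqr_ge0//=.
  by rewrite sqrtr_sqr ger0_norm.
(* With no large instance the maximum is always [delta] to the power 1/2, so the event in [hminimax]
   lies in the required one for each instance. *)
- apply: (@le_trans _ _ t%:E); first by rewrite lee_fin ge_min lexx.
  apply: (le_trans (hminimax fhat hfhat)).
  apply: ge_ereal_sup => _ [ft Fft <-].
  apply: le_ereal_sup_tmp; eexists; first by exists ft.
  apply: le_outerP => D /= dR; rewrite ge_max.
  have H : (delta%:E `^ 2^-1 <= risk w (mu ft.1 ft.2) ft.1 (fhat D) `^ 2^-1)%E.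
    have R0 := risk_ge0 w hw0 (mu ft.1 ft.2) ft.1 (fhat D).
    by rewrite !poweR12_sqrt ?lee_fin ?(ltW hdelta)// lee_sqrt.
  rewrite H (le_trans _ H)// leNgt; apply/negP => large.
  by apply: small; exists ft.
Qed.
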